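(* Let $\alpha\in(0,1/2)$. For each $r\in(0,1)$, $$\mathrm{det}_\infty^{f_\alpha}(\alpha r)\le\mathrm{det}_\infty^{f_\alpha}(r).$$ Moreover, for $r\le(1-2\alpha)/\alpha$ the equality holds.
   Context: For $\alpha\in(0,1/2)$ the continuous map $f_\alpha:[0,1]\to[0,1]$ is defined by: $f_\alpha(x)=x-1+2\alpha^{j-1}-\alpha^j$ for $x\in[1-\alpha^{j-1},1-\alpha^{j-1}+\alpha^j]$, $j\ge1$; $f_\alpha(x)=\frac{1-\alpha+\alpha^2}{2\alpha-1}(x-1)+\alpha^{j+1}\frac{2-\alpha}{2\alpha-1}$ for $x\in(1-\alpha^{j-1}+\alpha^j,1-\alpha^j)$, $j\ge1$; and $f_\alpha(1)=0$. For a word $u=u_1\dots u_k\in\{0,1\}^k$ put $\kappa(u)=(1-\alpha)\sum_{i=1}^k u_i\alpha^{i-1}$ and $I_\alpha(u)=[\kappa(u),\kappa(u)+\alpha^k]$. The measure $\mu_\alpha$ is the unique Borel probability measure on $[0,1]$ with $\mu_\alpha(I_\alpha(u))=2^{-k}$ for all $k\ge1$ and $u\in\{0,1\}^k$. For $1\le\ell\le\infty$ put $\varrho_\ell(x,y)=\sup\{|f_\alpha^i(x)-f_\alpha^i(y)| : 0\le i<\ell\}$ and $\mathrm{c}_\ell^{f_\alpha}(r)=\mu_\alpha\times\mu_\alpha\{(x,y):\varrho_\ell(x,y)\le r\}$ for $r>0$. The $\infty$-asymptotic determinism is $\mathrm{det}_\infty^{f_\alpha}(r)=\mathrm{c}_\infty^{f_\alpha}(r)/\mathrm{c}_1^{f_\alpha}(r)$.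 *)

(* Defs.v *)
From HB Require Import structures.
From mathcomp Require Import all_boot all_order all_algebra.
From mathcomp Require Import all_classical all_reals all_analysis.

Set Implicit Arguments.
Unset Strict Implicit.
Unset Printing Implicit Defensive.

Import Order.TTheory GRing.Theory Num.Theory.
Import numFieldNormedType.Exports.

Local Open Scope classical_set_scope.
Local Open Scope ring_scope.

Definition falpha_graph (R : realType) (alpha x y : R) : Prop :=
  [\/ exists j : nat,
        [/\ (1 <= j)%N,
            1 - alpha ^+ j.-1 <= x <= 1 - alpha ^+ j.-1 + alpha ^+ j &
            y = x - 1 + 2 * alpha ^+ j.-1 - alpha ^+ j],
      exists j : nat,
        [/\ (1 <= j)%N,
            1 - alpha ^+ j.-1 + alpha ^+ j < x < 1 - alpha ^+ j &
            y = (1 - alpha + alpha ^+ 2) / (2 * alpha - 1) * (x - 1)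
                + alpha ^+ j.+1 * ((2 - alpha) / (2 * alpha - 1))] |
      x = 1 /\ y = 0].

(* For 0 < alpha < 1/2 the domains of the clauses of [falpha_graph] are
   pairwise disjoint and cover [0, 1], so there [falpha alpha x] is the only y
   with [falpha_graph alpha x y].  Outside [0, 1] it is the junk value 0. *)
Definition falpha (R : realType) (alpha x : R) : R :=
  xget 0 [set y | falpha_graph alpha x y].

(* The letter u_i, 1 <= i <= k, is [tnth u (i - 1)], coerced from bool to nat. *)
Definition kappa (R : realType) (alpha : R) (k : nat) (u : k.-tuple bool) : R :=
  (1 - alpha) * \sum_(i < k) (tnth u i)%:R * alpha ^+ i.

Definition Ialpha (R : realType) (alpha : R) (k : nat) (u : k.-tuple bool)
    : set R :=
  [set` `[kappa alpha u, kappa alpha u + alpha ^+ k]].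

(* Borel probability measures on [0, 1] are Borel probability measures on R
   giving mass 1 to [0, 1].  Exactly one of them satisfies this predicate when
   0 < alpha < 1/2. *)
Definition is_mualpha (R : realType) (alpha : R)
    (mu : probability (measurableTypeR R) R) : Prop :=
  mu [set` `[0, 1]%R] = 1%E /\
  forall (k : nat) (u : k.-tuple bool), (1 <= k)%N ->
    mu (Ialpha alpha u) = (2 ^- k)%:E.

(* A length 1 <= l <= oo is an [option nat]: [Some l] is finite, [None] is oo. *)
Definition below_length (ell : option nat) (i : nat) : Prop :=
  if ell is Some l then (i < l)%N else True.

(* The supremum is taken in the extended reals; it is a real number when f maps
   [0, 1] to itself, x and y lie in [0, 1] and the length is at least 1. *)
Definition varrho (R : realType) (f : R -> R) (ell : option nat) (x y : R)
    : \bar R :=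
  ereal_sup [set `|iter i f x - iter i f y|%:E
            | i in [set i : nat | below_length ell i]].

Definition close_pairs (R : realType) (f : R -> R) (ell : option nat) (r : R)
    : set (measurableTypeR R * measurableTypeR R) :=
  [set p | [/\ 0 <= p.1 <= 1, 0 <= p.2 <= 1 &
               (varrho f ell p.1 p.2 <= r%:E)%E]].

Definition corr_sum (R : realType) (mu : probability (measurableTypeR R) R)
    (f : R -> R) (ell : option nat) (r : R) : R :=
  fine ((mu \x mu)%E (close_pairs f ell r)).

Definition det_oo (R : realType) (mu : probability (measurableTypeR R) R)
    (f : R -> R) (r : R) : R :=
  corr_sum mu f None r / corr_sum mu f (Some 1%N) r.

(* Main.v *)
(** The similarities S_a = [contr alpha a] : x |-> (1 - alpha) a + alpha x, a = 0, 1,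
    conjugate [falpha] to an odometer: f (S_0 x) = S_1 x and f (S_1 x) = S_0 (f x)
    on [0, 1].  Hence the orbit distance rho of S_a x and S_a y is alpha times
    that of x and y.  If x and y lie in the first-level cylinders, then the orbit
    distance of S_a x and S_b y, a <> b, is at least 1 - alpha > alpha: otherwise
    y < x < f y < f x < f (f y) (or the same with x and y exchanged), whereas f
    decreases the points of S_1 [0, 1] and maps S_0 [0, 1] to S_1 [0, 1].
    As mu is the average of its images under S_0 and S_1, mu x mu is the average
    of its images under the four S_a x S_b.  Therefore c_oo (alpha r) = c_oo (r) / 2,
    and c_1 (alpha r) >= c_1 (r) / 2, where equality holds as soon as
    alpha r <= 1 - 2 alpha, the width of the central gap. *)

Require Import Defs.
From mathcomp Require Import all_boot all_order all_algebra.
From mathcomp Require Import all_classical all_reals all_analysis.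
From mathcomp Require Import measurable_realfun.
From mathcomp Require Import ring lra.

Set Implicit Arguments.
Unset Strict Implicit.
Unset Printing Implicit Defensive.

Import Order.TTheory GRing.Theory Num.Theory.
Import numFieldNormedType.Exports.

Local Open Scope classical_set_scope.
Local Open Scope ring_scope.

(** * The map on [0, 1] *)

Definition contr (R : realType) (alpha : R) (a : bool) (x : R) : R :=
  (1 - alpha) * a%:R + alpha * x.

Lemma varrho_leP (R : realType) (f : R -> R) (ell : option nat) (x y r : R) :
  (varrho f ell x y <= r%:E)%E <->
  forall i, below_length ell i -> `|iter i f x - iter i f y| <= r.
Proof.
split=> [h i il|h].
  by rewrite -lee_fin; apply: le_trans h; apply: ereal_sup_ubound; exists i.
by apply: ge_ereal_sup => _ [i il <-]; rewrite lee_fin; exact: h.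
Qed.

Section odometer.
Variables (R : realType) (alpha : R).
Hypotheses (alpha_gt0 : 0 < alpha) (alpha_lt2 : 2 * alpha < 1).

Let alpha_lt1 : alpha < 1. Proof. by move: alpha_gt0 alpha_lt2; lra. Qed.

Let exp_le (m n : nat) : (m <= n)%N -> alpha ^+ n <= alpha ^+ m.
Proof. by move=> mn; apply: ler_wiXn2l => //; exact: ltW. Qed.

Let exp_gt0 (n : nat) : 0 < alpha ^+ n. Proof. exact: exprn_gt0. Qed.

Let exp_gap (n : nat) : 2 * alpha ^+ n.+1 < alpha ^+ n.
Proof. by rewrite exprS; have := exp_gt0 n; move: alpha_lt2; nra. Qed.

Lemma exists_piece (x : R) : 0 <= x < 1 ->
  exists n : nat, 1 - alpha ^+ n <= x < 1 - alpha ^+ n.+1.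
Proof.
have [a0 a2 a1] := And3 alpha_gt0 alpha_lt2 alpha_lt1.
move=> /andP[x0 x1].
have ex : exists n : nat, x < 1 - alpha ^+ n.
  have cv : alpha ^+ n @[n --> \oo] --> (0 : R).
    by apply: cvg_expr; rewrite ger0_norm// ltW.
  have x1' : 0 < 1 - x by lra.
  move/cvgr_lt : cv => /(_ _ x1')[n _ /(_ n (leqnn n))/= an].
  by exists n; move: an; lra.
have := ex_minnP ex => -[[|n] xn nmin]; first by move: xn; rewrite expr0; lra.
exists n; rewrite xn andbT leNgt; apply/negP => /nmin.
by rewrite ltnn.
Qed.

(** The two clauses of index [j = n.+1] split this interval at [1 - alpha ^+ n + alpha ^+ n.+1],
    which lies strictly inside it because [2 * alpha < 1]. The intervals are disjoint for distinct
    [n], so no other index can apply to [x]. *)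
Lemma falpha_graph_in_piece (n : nat) (x y : R) :
  1 - alpha ^+ n <= x < 1 - alpha ^+ n.+1 ->
  falpha_graph alpha x y ->
  y = if x <= 1 - alpha ^+ n + alpha ^+ n.+1
      then x - 1 + 2 * alpha ^+ n - alpha ^+ n.+1
      else (1 - alpha + alpha ^+ 2) / (2 * alpha - 1) * (x - 1)
           + alpha ^+ n.+2 * ((2 - alpha) / (2 * alpha - 1)).
Proof.
have [a0 a2 a1] := And3 alpha_gt0 alpha_lt2 alpha_lt1.
move=> /andP[nx xn].
have uniq (m : nat) : 1 - alpha ^+ m <= x < 1 - alpha ^+ m.+1 -> m = n.
  move=> /andP[mx xm]; case: (ltngtP m n) => // /exp_le ?; exfalso; lra.
move=> [[[|j] [// _ /andP[jx xj] ->]]|[[|j] [// _ /andP[jx xj] ->]]|[x1 _]] /=.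
- rewrite /= in jx xj; have ? := uniq j; have ? := exp_gap j.
  have -> : n = j by symmetry; apply: uniq; lra.
  by rewrite xj.
- rewrite /= in jx xj; have ? := exp_gap j; have ? := exp_gt0 j.+1.
  have -> : n = j by symmetry; apply: uniq; lra.
  by rewrite leNgt jx.
- by have := exp_gt0 n.+1; lra.
Qed.

Lemma falpha_in_piece (n : nat) (x : R) :
  1 - alpha ^+ n <= x < 1 - alpha ^+ n.+1 ->
  falpha alpha x = if x <= 1 - alpha ^+ n + alpha ^+ n.+1
      then x - 1 + 2 * alpha ^+ n - alpha ^+ n.+1
      else (1 - alpha + alpha ^+ 2) / (2 * alpha - 1) * (x - 1)
           + alpha ^+ n.+2 * ((2 - alpha) / (2 * alpha - 1)).
Proof.
have [a0 a2 a1] := And3 alpha_gt0 alpha_lt2 alpha_lt1.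
move=> xn; apply: (falpha_graph_in_piece xn).
suff : exists y, falpha_graph alpha x y by case=> y yP; exact: (xgetI 0 yP).
have /andP[nx xn'] := xn.
case: (leP x (1 - alpha ^+ n + alpha ^+ n.+1)) => xc.
  by eexists; apply: Or31; exists n.+1; split=> //=; rewrite nx xc.
by eexists; apply: Or32; exists n.+1; split=> //=; rewrite xc xn'.
Qed.

Lemma falpha1 : falpha alpha 1 = 0.
Proof.
have [a0 a2 a1] := And3 alpha_gt0 alpha_lt2 alpha_lt1.
have : falpha_graph alpha 1 (falpha alpha 1).
  have yP : [set y | falpha_graph alpha 1 y] 0 by exact: Or33.
  exact: (xgetI 0 yP).
move=> [[[|j] [// _ /andP[jx xj] _]]|[[|j] [// _ /andP[jx xj] _]]|[_ //]] /=.
  by move: jx xj => /=; have := exp_gap j; have := exp_gt0 j.+1; lra.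
by move: jx xj => /=; have := exp_gap j; have := exp_gt0 j.+1; lra.
Qed.

(** Every clause of the graph forces [x] into [0, 1], so [xget] returns its default here. This makes
    [falpha] measurable on the whole line. *)
Lemma falpha_outside (x : R) : ~~ (0 <= x <= 1) -> falpha alpha x = 0.
Proof.
have [a0 a2 a1] := And3 alpha_gt0 alpha_lt2 alpha_lt1.
move=> xout; rewrite /falpha xgetPN// => y.
have le1 (m : nat) : alpha ^+ m <= 1 by apply: exprn_ile1 => //; exact: ltW.
move=> [[[|j] [// _ /andP[jx xj] _]]|[[|j] [// _ /andP[jx xj] _]]|[x1 _]] /=;
  move/negP: xout; apply.
- by move: jx xj => /=; have := exp_gap j; have := exp_gt0 j.+1; have := le1 j; lra.
- by move: jx xj => /=; have := exp_gap j; have := exp_gt0 j.+1; have := le1 j; lra.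
- by rewrite x1 lexx ler01.
Qed.

Lemma contr_itv (a : bool) (x : R) : 0 <= x <= 1 -> 0 <= contr alpha a x <= 1.
Proof.
have [a0 a2 a1] := And3 alpha_gt0 alpha_lt2 alpha_lt1.
by rewrite /contr; case: a => /=; nra.
Qed.

(** The image of [0, 1] under [contr alpha false] is [0, alpha], the domain of the first clause with
    [j = 1], which is the translation by [1 - alpha]. *)
Lemma falpha_contr0 (x : R) : 0 <= x <= 1 ->
  falpha alpha (contr alpha false x) = contr alpha true x.
Proof.
have [a0 a2 a1] := And3 alpha_gt0 alpha_lt2 alpha_lt1.
move=> x01; rewrite (@falpha_in_piece 0).
  by rewrite /contr /= expr0 expr1 ifT; [ring | nra].
by rewrite /contr /= expr0 expr1; nra.
Qed.

(** The map [contr alpha true] fixes 1 and carries piece [n] onto piece [n.+1], break point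
    included; the affine formulas on the two pieces correspond under scaling by [alpha]. *)
Lemma falpha_contr1 (x : R) : 0 <= x <= 1 ->
  falpha alpha (contr alpha true x) = contr alpha false (falpha alpha x).
Proof.
have [a0 a2 a1] := And3 alpha_gt0 alpha_lt2 alpha_lt1.
move=> /andP[x0]; rewrite le_eqVlt => /orP[/eqP ->|x1].
  rewrite /contr !mulr1 mulr0 add0r subrK falpha1 mulr0//.
have [n /andP[nx xn]] : exists n : nat, 1 - alpha ^+ n <= x < 1 - alpha ^+ n.+1.
  by apply: exists_piece; rewrite x0.
have h1 : alpha * (1 - alpha ^+ n) <= alpha * x by rewrite ler_pM2l.
have h2 : alpha * x < alpha * (1 - alpha ^+ n.+1) by rewrite ltr_pM2l.
rewrite (@falpha_in_piece n x) ?nx// (@falpha_in_piece n.+1); last first.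
  by rewrite !exprS in h2 *; rewrite /contr /= mulr1; lra.
have -> : (contr alpha true x <= 1 - alpha ^+ n.+1 + alpha ^+ n.+2) =
          (x <= 1 - alpha ^+ n + alpha ^+ n.+1).
  rewrite -[RHS](ler_pM2l alpha_gt0) /contr /= mulr1 !exprS.
  by apply/idP/idP; lra.
have ? : 2 * alpha - 1 != 0 by lra.
by case: ifP => _; rewrite /contr mulr1 mulr0 !exprS; field.
Qed.

Lemma falpha_itv (x : R) : 0 <= x <= 1 -> 0 <= falpha alpha x <= 1.
Proof.
have [a0 a2 a1] := And3 alpha_gt0 alpha_lt2 alpha_lt1.
move=> /andP[x0]; rewrite le_eqVlt => /orP[/eqP ->|x1].
  by rewrite falpha1 lexx ler01.
have [n /andP[nx xn]] : exists n : nat, 1 - alpha ^+ n <= x < 1 - alpha ^+ n.+1.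
  by apply: exists_piece; rewrite x0.
rewrite (@falpha_in_piece n) ?nx//.
have p0 : 0 < alpha ^+ n by rewrite exprn_gt0.
have p1 : alpha ^+ n <= 1 by apply: exprn_ile1 => //; exact: ltW.
have p2 : 2 * alpha ^+ n.+1 < alpha ^+ n by rewrite exprS; nra.
have p3 : 0 < alpha ^+ n.+1 by rewrite exprn_gt0.
case: (leP x (1 - alpha ^+ n + alpha ^+ n.+1)) => xc; first by lra.
have d : 0 < 1 - 2 * alpha by lra.
(* Over the positive denominator [1 - 2 * alpha] the numerator is nonincreasing in [x]. Its values
   at the right and left ends of the branch are [alpha ^+ n.+1 * (1 - alpha) * (1 - 2 * alpha)] and
   [alpha ^+ n * (1 - 2 * alpha)]; the products [h1] and [h2] below encode these two bounds. *)
have -> : (1 - alpha + alpha ^+ 2) / (2 * alpha - 1) * (x - 1)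
  + alpha ^+ n.+2 * ((2 - alpha) / (2 * alpha - 1))
  = ((1 - alpha + alpha ^+ 2) * (1 - x) - alpha ^+ n.+1 * alpha * (2 - alpha)) / (1 - 2 * alpha).
  have ? : 2 * alpha - 1 != 0 by lra.
  have ? : 1 - 2 * alpha != 0 by lra.
  by rewrite (exprSr _ n.+1); field; apply/andP.
have q0 : 0 <= 1 - alpha + alpha ^+ 2 by nra.
rewrite ler_pdivrMr// mul1r; apply/andP; split.
  apply: divr_ge0; last exact: ltW.
  have h1 : 0 <= alpha ^+ n.+1 * ((1 - alpha) * (1 - 2 * alpha)).
    by rewrite !mulr_ge0//; lra.
  have h2 : 0 <= (1 - x - alpha ^+ n.+1) * (1 - alpha + alpha ^+ 2).
    by rewrite mulr_ge0//; lra.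
  lra.
rewrite exprS in xc *.
have h1 : 0 <= (1 - alpha ^+ n) * (1 - 2 * alpha) by rewrite mulr_ge0//; lra.
have h2 : 0 <= (x - (1 - alpha ^+ n + alpha * alpha ^+ n)) * (1 - alpha + alpha ^+ 2).
  by rewrite mulr_ge0//; lra.
lra.
Qed.

Lemma iter_falpha_itv (n : nat) (x : R) : 0 <= x <= 1 ->
  0 <= iter n (falpha alpha) x <= 1.
Proof. by move=> x01; elim: n => //= n; exact: falpha_itv. Qed.

(** Two odometer steps restore the first digit and carry exactly once into the remaining digits. *)
Lemma iter_falpha_contr (a : bool) (n : nat) (x : R) : 0 <= x <= 1 ->
  iter n.*2 (falpha alpha) (contr alpha a x) =
  contr alpha a (iter n (falpha alpha) x).
Proof.
have [a0 a2 a1] := And3 alpha_gt0 alpha_lt2 alpha_lt1.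
move=> x01; elim: n => //= n ->; have xn := iter_falpha_itv n x01.
case: a; last by rewrite falpha_contr0// falpha_contr1.
by rewrite falpha_contr1// falpha_contr0// falpha_itv.
Qed.

(** The extra step flips the first digit and carries only when that digit was 1, whence the count
    [a + n]. *)
Lemma iter_falpha_contr_odd (a : bool) (n : nat) (x : R) : 0 <= x <= 1 ->
  iter n.*2.+1 (falpha alpha) (contr alpha a x) =
  contr alpha (~~ a) (iter (a + n) (falpha alpha) x).
Proof.
move=> x01; rewrite iterS iter_falpha_contr//; have xn := iter_falpha_itv n x01.
by case: a => /=; [rewrite falpha_contr1|rewrite falpha_contr0].
Qed.

Lemma varrho_contr_eq (a : bool) (x y r : R) : 0 <= x <= 1 -> 0 <= y <= 1 ->
  (varrho (falpha alpha) None (contr alpha a x) (contr alpha a y)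
    <= (alpha * r)%:E)%E <->
  (varrho (falpha alpha) None x y <= r%:E)%E.
Proof.
move=> x01 y01.
have dist (b : bool) (u v : R) :
    (`|contr alpha b u - contr alpha b v| <= alpha * r) = (`|u - v| <= r).
  have -> : contr alpha b u - contr alpha b v = alpha * (u - v).
    by rewrite /contr; ring.
  by rewrite normrM gtr0_norm// ler_pM2l.
(* Even times already run through all distances of the original orbits, scaled by [alpha]; for the
   converse, odd times give again such scaled distances. *)
split=> /varrho_leP xy; apply/varrho_leP => i _.
  by have := xy i.*2 Logic.I; rewrite !iter_falpha_contr// dist.
rewrite -(odd_double_half i); case: (odd i) => /=.
  by rewrite add0n -!iterS !iter_falpha_contr_odd// dist; exact: xy.
by rewrite add0n !iter_falpha_contr// dist; exact: xy.
Qed.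

Lemma varrho_contr_neq (x y r : R) : 0 <= x <= 1 -> r < 1 ->
  (exists b y', 0 <= y' <= 1 /\ y = contr alpha b y') ->
  ~ (varrho (falpha alpha) None (contr alpha false x) (contr alpha true y)
      <= (alpha * r)%:E)%E.
Proof.
have [a0 a2 a1] := And3 alpha_gt0 alpha_lt2 alpha_lt1.
move=> x01 r1 [b [y' [y'01 yE]]] /varrho_leP xy.
have y01 : 0 <= y <= 1 by rewrite yE; exact: contr_itv.
have ar : alpha * r < 1 - alpha by nra.
(* The offset [1 - alpha] between the two similarities exceeds [alpha * r], so the point in the
   upper copy must come from the smaller original point. *)
have even n : iter n (falpha alpha) y < iter n (falpha alpha) x.
  have := xy n.*2 Logic.I; rewrite !iter_falpha_contr// distrC => /ler_normlW.
  by rewrite /contr /=; nra.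
(* At odd times the copies are exchanged and only the orbit of [y] has carried. *)
have odd n : iter n (falpha alpha) x < iter n.+1 (falpha alpha) y.
  have := xy n.*2.+1 Logic.I; rewrite !iter_falpha_contr_odd// => /ler_normlW.
  by rewrite /contr /= add0n; nra.
have incr n : iter n (falpha alpha) y < iter n.+1 (falpha alpha) y.
  exact: lt_trans (even n) (odd n).
have drop z : 0 <= z <= 1 ->
    falpha alpha (contr alpha true z) < contr alpha true z.
  move=> z01; rewrite falpha_contr1//.
  by have := falpha_itv z01; rewrite /contr /=; nra.
(* The orbit of [y] is in the upper copy at time 0 if [b] is true and at time 1 otherwise; there
   [drop] contradicts the strict increase. *)
case: b yE => yE; first by have := incr 0; rewrite yE /= ltNge ltW ?drop.
by have := incr 1; rewrite yE /= falpha_contr0// ltNge ltW ?drop.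
Qed.

Lemma measurable_falpha :
  measurable_fun [set: R] (falpha alpha : measurableTypeR R -> measurableTypeR R).
Proof.
have [a0 a2 a1] := And3 alpha_gt0 alpha_lt2 alpha_lt1.
pose E n := [set` `[1 - alpha ^+ n, 1 - alpha ^+ n.+1[] : set (measurableTypeR R).
have mE n : measurable (E n) by exact: measurable_itv.
have mf n : measurable_fun (E n) (falpha alpha : measurableTypeR R -> measurableTypeR R).
  apply: (eq_measurable_fun (fun x : measurableTypeR R =>
     if x <= 1 - alpha ^+ n + alpha ^+ n.+1
      then x - 1 + 2 * alpha ^+ n - alpha ^+ n.+1
      else (1 - alpha + alpha ^+ 2) / (2 * alpha - 1) * (x - 1)
           + alpha ^+ n.+2 * ((2 - alpha) / (2 * alpha - 1)))).
    by move=> x; rewrite inE => xn; rewrite (falpha_in_piece xn).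
  apply: measurable_funTS; apply: measurable_fun_ifT.
  - exact: measurable_fun_ler.
  - apply: measurable_funB => //; apply: measurable_funD => //.
    exact: measurable_funB.
  - apply: measurable_funD => //; apply: measurable_funM => //.
    exact: measurable_funB.
(* The pieces accumulate at 1 and cover only [0, 1), so the point 1 and the outside are treated
   apart. *)
have -> : [set: R] = (\bigcup_n E n) `|` ([set 1] `|` ~` [set` `[0, 1]]).
  apply/esym; rewrite -subTset => x _.
  have [x01|x01] := boolP (0 <= x <= 1); last first.
    by right; right => /=; rewrite in_itv/=; exact/negP.
  have [->|x1] := eqVneq x 1; first by right; left.
  have [n xn] : exists n : nat, 1 - alpha ^+ n <= x < 1 - alpha ^+ n.+1.
    by apply: exists_piece; move: x01 => /andP[-> ?]; rewrite lt_neqAle x1.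
  by left; exists n => //=; rewrite in_itv.
have m01 : measurable ([set` `[0, 1]] : set (measurableTypeR R)).
  exact: measurable_itv.
have m1 : measurable ([set 1] : set (measurableTypeR R)).
  exact: measurable_set1.
have mU := bigcupT_measurable _ mE.
apply/(measurable_funU _ mU (measurableU _ _ m1 (measurableC m01))).
split; first exact/measurable_fun_bigcup.
apply/(measurable_funU _ m1 (measurableC m01)); split; first exact: measurable_fun_set1.
apply: (eq_measurable_fun
  (cst 0 : measurableTypeR R -> measurableTypeR R)) => // x.
rewrite inE /= in_itv/= => /negP xout.
by rewrite falpha_outside.
Qed.
End odometer.

(** * Cylinders and uniqueness of the measure *)

(** The defining condition starts at length 1; the cylinder of the empty word is [0, 1], whose mass
    is the other condition. *)
Lemma is_mualpha_cyl (R : realType) (alpha : R)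
  (mu : probability (measurableTypeR R) R) : is_mualpha alpha mu ->
  forall (k : nat) (u : k.-tuple bool), mu (Ialpha alpha u) = (2 ^- k)%:E.
Proof.
move=> [mu01 muI] [|k] u; last exact: muI.
rewrite expr0 invr1 -mu01; congr (mu _).
by rewrite /Ialpha /kappa big_ord0 mulr0 add0r expr0.
Qed.

Section cylinders.
Variables (R : realType) (alpha : R).
Hypotheses (alpha_gt0 : 0 < alpha) (alpha_lt2 : 2 * alpha < 1).
Implicit Types (k : nat) (a b : bool) (x : R).

Lemma kappa_cons k (a : bool) (u : k.-tuple bool) :
  kappa alpha [tuple of a :: u] = contr alpha a (kappa alpha u).
Proof.
rewrite /kappa /contr big_ord_recl tnth0 expr0 mulr1 mulrDr; congr (_ + _).
rewrite mulrCA; congr (_ * _); rewrite mulr_sumr; apply: eq_bigr => i _.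
by rewrite tnthS exprS mulrCA.
Qed.

Lemma Ialpha_cons k (a : bool) (u : k.-tuple bool) (x : R) :
  Ialpha alpha [tuple of a :: u] (contr alpha a x) <-> Ialpha alpha u x.
Proof.
have a0 := alpha_gt0.
rewrite /Ialpha /= !in_itv/= kappa_cons /contr exprS.
have -> : (1 - alpha) * a%:R + alpha * kappa alpha u + alpha * alpha ^+ k =
  (1 - alpha) * a%:R + alpha * (kappa alpha u + alpha ^+ k) by ring.
by rewrite !lerD2l !ler_pM2l.
Qed.

Lemma contr_surj (a : bool) (x : R) : exists y, x = contr alpha a y.
Proof.
exists ((x - (1 - alpha) * a%:R) / alpha).
by rewrite /contr (mulrC alpha) divfK ?gt_eqF// subrKC.
Qed.

Lemma Ialpha_sub01 k (u : k.-tuple bool) : Ialpha alpha u `<=` [set` `[0, 1]].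
Proof.
have [a0 a2] := (alpha_gt0, alpha_lt2).
elim: k u => [u|k IH u] x.
  by rewrite /Ialpha /kappa big_ord0 mulr0 add0r expr0.
case/tupleP: u => a u; have [y ->] := contr_surj a x.
move=> /Ialpha_cons/IH /=; rewrite !in_itv/= /contr.
by case: a => /=; nra.
Qed.

(** The two images of [0, 1] are [0, alpha] and [1 - alpha, 1], separated since
    [alpha < 1 - alpha]. *)
Lemma contr_far (a b : bool) (x y : R) : 0 <= x <= 1 -> 0 <= y <= 1 ->
  contr alpha a x = contr alpha b y -> a = b.
Proof.
have [a0 a2] := (alpha_gt0, alpha_lt2).
by rewrite /contr; case: a; case: b => //= x01 y01 h; exfalso; nra.
Qed.

Lemma Ialpha_cons_neq k (a b : bool) (u : k.-tuple bool) (x : R) :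
  0 <= x <= 1 -> Ialpha alpha [tuple of a :: u] (contr alpha b x) -> a = b.
Proof.
move=> x01; have [y E] := contr_surj a (contr alpha b x).
rewrite E => /Ialpha_cons /Ialpha_sub01 /=; rewrite in_itv/= => y01.
by apply/esym; exact: contr_far E.
Qed.

Lemma Ialpha_disjoint k (u v : k.-tuple bool) (x : R) :
  Ialpha alpha u x -> Ialpha alpha v x -> u = v.
Proof.
elim: k u v x => [u v x _ _|k IH u v x]; first by rewrite [u]tuple0 [v]tuple0.
case/tupleP: u => a u; case/tupleP: v => b v.
have [y ->] := contr_surj a x; move=> /Ialpha_cons uy.
have := Ialpha_sub01 uy; rewrite /= in_itv/= => y01 bv.
have ba := Ialpha_cons_neq y01 bv; rewrite ba in bv *.
by move/Ialpha_cons : bv => /(IH u v y uy) ->.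
Qed.

Lemma measurable_Ialpha k (u : k.-tuple bool) :
  measurable (Ialpha alpha u : set (measurableTypeR R)).
Proof. exact: measurable_itv. Qed.

(** The value depends on [D] and [k] alone, so measures with the same cylinder masses agree on such
    unions. *)
Lemma measure_bigcup_Ialpha (m : {measure set (measurableTypeR R) -> \bar R})
    k (D : set (k.-tuple bool)) :
  (forall u : k.-tuple bool, m (Ialpha alpha u) = (2 ^- k)%:E) ->
  m (\bigcup_(u in D) Ialpha alpha u) = (\sum_(u \in D) (2 ^- k : R)%:E)%E.
Proof.
move=> mI; rewrite measure_fin_bigcup.
- by apply: eq_fsbigr => u _; exact: mI.
- exact: finite_finset.
- by move=> u v _ _ [x [ux vx]]; exact: Ialpha_disjoint ux vx.
- by move=> u _; exact: measurable_Ialpha.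
Qed.

(** The [2 ^ k] disjoint cylinders of mass [2 ^- k] exhaust the total mass 1. *)
Lemma measure_setC_Ialpha (m : {measure set (measurableTypeR R) -> \bar R}) k :
  m setT = 1%E ->
  (forall u : k.-tuple bool, m (Ialpha alpha u) = (2 ^- k)%:E) ->
  m (~` \bigcup_(u : k.-tuple bool) Ialpha alpha u) = 0%E.
Proof.
move=> mT mI; set U := \bigcup_u _.
have mU : measurable (U : set (measurableTypeR R)).
  apply: fin_bigcup_measurable; first exact: finite_finset.
  by move=> u _; exact: measurable_Ialpha.
have U1 : m U = 1%E.
  rewrite measure_bigcup_Ialpha//.
  have -> : [set: k.-tuple bool] = [set` enum {: k.-tuple bool}].
    by apply/esym; rewrite -subTset => u _ /=; rewrite mem_enum.
  rewrite -fsbig_seq ?enum_uniq// big_enum /= sumEFin sumr_const.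
  by rewrite card_tuple card_bool -[_ *+ _]mulr_natr natrX mulVf// expf_neq0.
have : (m U + m (~` U) = 1)%E.
  by rewrite -measureU// ?setUv//; [exact: measurableC|rewrite setICr].
rewrite U1; have := measure_ge0 m (~` U).
case: (m (~` U)) => // z _ /eqP.
by rewrite -EFinD eqe => /eqP z0; congr (_%:E); lra.
Qed.

End cylinders.

Section uniqueness.
Variables (R : realType) (alpha : R).
Hypotheses (alpha_gt0 : 0 < alpha) (alpha_lt2 : 2 * alpha < 1).

(** Up to a null set, the ray is covered by the level-[k] cylinders that meet it. Both measures give
    their union the same mass, and it stays within [alpha ^+ k] of the ray, the length of a
    cylinder. *)
Lemma measure_ray_le (m1 m2 : {measure set (measurableTypeR R) -> \bar R})
  (t : R) (k : nat) :
  m1 setT = 1%E ->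
  (forall u : k.-tuple bool, m1 (Ialpha alpha u) = (2 ^- k)%:E) ->
  (forall u : k.-tuple bool, m2 (Ialpha alpha u) = (2 ^- k)%:E) ->
  (m1 `[t, +oo[%classic <= m2 `[(t - alpha ^+ k)%R, +oo[%classic)%E.
Proof.
move=> m1T m1I m2I.
pose D := [set u : k.-tuple bool | Ialpha alpha u `&` `[t, +oo[ !=set0].
have mb (E : set (k.-tuple bool)) :
    measurable (\bigcup_(u in E) Ialpha alpha u : set (measurableTypeR R)).
  apply: fin_bigcup_measurable; first exact: finite_finset.
  by move=> u _; exact: measurable_itv.
apply: (@le_trans _ _ (m1 (\bigcup_(u in D) Ialpha alpha u))).
  rewrite -[leRHS](measureU0 _ _ (measure_setC_Ialpha alpha_gt0 alpha_lt2 m1T m1I)) //.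
    apply: le_measure; rewrite ?inE.
    - exact: measurable_itv.
    - by apply: measurableU => //; apply: measurableC.
    - move=> x tx.
      have [[u _ ux]|] := pselect ((\bigcup_(u : k.-tuple bool) Ialpha alpha u) x).
        by left; exists u => //; exists x.
      by right.
  exact: measurableC.
rewrite (measure_bigcup_Ialpha alpha_gt0 alpha_lt2 D m1I).
rewrite -(measure_bigcup_Ialpha alpha_gt0 alpha_lt2 D m2I).
apply: le_measure; rewrite ?inE//.
move=> x [u [y [/= uy ty]] /= ux].
by move: uy ty ux; rewrite /Ialpha /= !in_itv/= !andbT; lra.
Qed.

(** Letting [k] tend to infinity in [measure_ray_le], in both directions, yields agreement on closed
    rays, a pi-system generating the Borel sets. *)
Lemma measure_Ialpha_unique (m1 m2 : {measure set (measurableTypeR R) -> \bar R}) :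
  m1 setT = 1%E -> m2 setT = 1%E ->
  (forall k (u : k.-tuple bool), m1 (Ialpha alpha u) = (2 ^- k)%:E) ->
  (forall k (u : k.-tuple bool), m2 (Ialpha alpha u) = (2 ^- k)%:E) ->
  forall A, measurable A -> m1 A = m2 A.
Proof.
move=> m1T m2T m1I m2I A mA.
have a1 : alpha < 1 by move: alpha_gt0 alpha_lt2; lra.
have ray (n1 n2 : {measure set (measurableTypeR R) -> \bar R}) (t : R) :
    n1 setT = 1%E -> n2 setT = 1%E ->
    (forall k (u : k.-tuple bool), n1 (Ialpha alpha u) = (2 ^- k)%:E) ->
    (forall k (u : k.-tuple bool), n2 (Ialpha alpha u) = (2 ^- k)%:E) ->
    (n1 `[t, +oo[%classic <= n2 `[t, +oo[%classic)%E.
  move=> n1T n2T n1I n2I.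
  pose F k := [set` `[t - alpha ^+ k, +oo[] : set (measurableTypeR R).
  have mF k : measurable (F k) by exact: measurable_itv.
  have capF : \bigcap_k F k = `[t, +oo[%classic.
    apply/seteqP; split=> x /=; last first.
      rewrite in_itv/= andbT => tx n _; rewrite /F/= in_itv/= andbT.
      by rewrite lerBlDr (le_trans tx)// lerDl exprn_ge0// ltW.
    move=> Fx; rewrite in_itv/= andbT leNgt; apply/negP => xt.
    have cv : alpha ^+ n @[n --> \oo] --> (0 : R).
      by apply: cvg_expr; rewrite ger0_norm// ltW.
    have tx0 : 0 < t - x by rewrite subr_gt0.
    move/cvgr_lt : cv => /(_ _ tx0)[n _ /(_ n (leqnn n))/= an].
    by have := Fx n Logic.I; rewrite /F/= in_itv/= andbT; lra.
  (* Continuity from above along the shifted rays, which decrease to the ray at [t]. *)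
  have cvF : (n2 \o F) k @[k --> \oo] --> n2 (\bigcap_k F k).
    apply: nonincreasing_cvg_mu => //.
    - apply: (@le_lt_trans _ _ (n2 setT)); last by rewrite n2T ltry.
      by apply: le_measure; rewrite ?inE.
    - exact: bigcapT_measurable.
    - move=> i j ij; apply/subsetPset => x; rewrite /F/= !in_itv/= !andbT.
      apply: le_trans; rewrite lerD2l lerN2.
      by apply: ler_wiXn2l => //; exact: ltW.
  rewrite -[in leRHS]capF -(cvg_lim _ cvF)//; apply: lime_ge; first by apply: cvgP cvF.
  by apply: nearW => k; exact: measure_ray_le.
apply: (@measure_unique _ R (measurableTypeR R) (@RGenCInfty.G R)
  (fun n : nat => [set` `[- n%:R, +oo[]) _ _ _ _ m1 m2) => //.
- exact: RGenCInfty.measurableE.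
- move=> _ _ [s ->] [t ->]; exists (Order.max s t).
  by apply/seteqP; split=> x /=; rewrite !in_itv/= !andbT ge_max => /andP.
- by move=> i; exists (- i%:R).
- rewrite -subTset => x _.
  have [n _ xn] := nbhs_infty_gtr (- x).
  by exists n => //=; rewrite in_itv/= andbT lerNl ltW// xn/=.
- by move=> _ [t ->]; apply/eqP; rewrite eq_le !ray.
- move=> k; apply: (@le_lt_trans _ _ (m1 setT)); last by rewrite m1T ltry.
  by apply: le_measure; rewrite ?inE//; exact: measurable_itv.
Qed.
End uniqueness.

(** * Self-similarity of the measure *)

(** Packages the average of two image measures as a measure, so that uniqueness theorems apply to
    it. *)
Lemma average_measure d (T : measurableType d) (R : realType)
    (m : {measure set T -> \bar R}) (f g : T -> T) :
  measurable_fun setT f -> measurable_fun setT g ->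
  exists n : {measure set T -> \bar R},
    forall A, n A = (2^-1%:E * (m (f @^-1` A) + m (g @^-1` A)))%E.
Proof.
move=> mf mg.
unshelve eexists (mscale (2^-1)%:nng
  (measure_add (pushforward m f) (pushforward m g))) => // A.
exact: (congr1 (fun z => 2^-1%:E * z)%E (measure_addE _ _ A)).
Qed.

Lemma measureI_conull d (T : measurableType d) (R : realType)
    (m : {measure set T -> \bar R}) (G X : set T) :
  measurable G -> measurable X -> m (~` G) = 0%E -> m X = m (X `&` G).
Proof.
move=> mG mX G0.
have mXG : measurable (X `&` ~` G) by apply: measurableI => //; exact: measurableC.
rewrite -[in LHS](setIT X) -(setUv G) setIUr measureU0//.
  exact: measurableI.
by apply: subset_measure0 G0 => //; exact: measurableC.
Qed.

Section selfsimilar.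
Variables (R : realType) (alpha : R).
Hypotheses (alpha_gt0 : 0 < alpha) (alpha_lt2 : 2 * alpha < 1).
Variable mu : probability (measurableTypeR R) R.
Hypothesis hmu : is_mualpha alpha mu.

Local Notation sim := (contr alpha : bool -> measurableTypeR R -> measurableTypeR R).

Lemma measurable_contr (a : bool) : measurable_fun [set: measurableTypeR R] (sim a).
Proof.
by apply: measurable_funD => //; apply: measurable_funM.
Qed.

Let mS (a : bool) (B : set (measurableTypeR R)) :
  measurable B -> measurable (sim a @^-1` B).
Proof.
by move=> mB; rewrite -[X in measurable X]setTI; exact: measurable_contr.
Qed.

Let mu_setC01 : mu (~` [set` `[0, 1]]) = 0%E.
Proof.
rewrite probability_setC; last exact: measurable_itv.
by rewrite hmu.1 subee.
Qed.

(** By [measure_Ialpha_unique] it suffices that the average has the right cylinder masses. For the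
    word [a :: u], the preimage under [sim a] is the cylinder of [u], and the other preimage misses
    [0, 1]. *)
Lemma mu_selfsimilar (A : set (measurableTypeR R)) : measurable A ->
  mu A = (2^-1%:E * (mu (sim false @^-1` A) + mu (sim true @^-1` A)))%E.
Proof.
move=> mA.
have [n nE] := average_measure mu (measurable_contr false) (measurable_contr true).
have m01 : measurable ([set` `[0, 1]] : set (measurableTypeR R)).
  exact: measurable_itv.
rewrite -nE; apply: (measure_Ialpha_unique alpha_gt0 alpha_lt2) => //.
- exact: probability_setT.
- transitivity (2^-1%:E * (1 + 1) : \bar R)%E.
    by rewrite nE; congr (_ * (_ + _))%E; exact: probability_setT.
  rewrite -EFinD -EFinM.
  by congr (_%:E); lra.
- exact: is_mualpha_cyl.
move=> [|k] u.
  have -> : Ialpha alpha u = [set` `[0, 1]].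
    by rewrite /Ialpha /kappa big_ord0 mulr0 add0r expr0.
  have S01 a : mu (sim a @^-1` [set` `[0, 1]]) = 1%E.
    apply/eqP; rewrite eq_le; apply/andP; split.
      by apply: probability_le1; exact: mS.
    rewrite -hmu.1; apply: le_measure; rewrite ?inE//; first exact: mS.
    by move=> x /=; rewrite !in_itv/=; exact: contr_itv.
  transitivity (2^-1%:E * (1 + 1) : \bar R)%E.
    by rewrite nE; congr (_ * (_ + _))%E; exact: S01.
  rewrite -EFinD -EFinM expr0.
  by congr (_%:E); lra.
case/tupleP: u => a u.
have same : mu (sim a @^-1` Ialpha alpha [tuple of a :: u]) = (2 ^- k)%:E.
  rewrite -(is_mualpha_cyl hmu u); congr (mu _).
  by apply/seteqP; split=> x /Ialpha_cons; apply.
have other : mu (sim (~~ a) @^-1` Ialpha alpha [tuple of a :: u]) = 0%E.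
  apply: subset_measure0 mu_setC01; [|exact: measurableC|].
    by apply: mS; exact: measurable_Ialpha.
  move=> x xI /=; rewrite in_itv/= => x01.
  by have := Ialpha_cons_neq alpha_gt0 alpha_lt2 x01 xI; case: (a).
rewrite nE exprS invfM EFinM; congr (_ * _)%E.
case: a same other => /= same other.
  by rewrite -[RHS]add0e; congr (_ + _)%E.
by rewrite -[RHS]adde0; congr (_ + _)%E.
Qed.

(** The preimages of 0 are 0 itself and a negative point, so self-similarity makes this mass half of
    itself. It settles the borderline radius in [corr_sum1_scale]. *)
Lemma mu_set1_0 : mu [set 0] = 0%E.
Proof.
have a0 := alpha_gt0.
have := mu_selfsimilar (measurable_set1 0).
have -> : sim false @^-1` [set 0] = [set 0].
  apply/seteqP; split=> x /=; rewrite /contr mulr0 add0r; last by move=> ->; rewrite mulr0.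
  by move/eqP; rewrite mulf_eq0 gt_eqF//= => /eqP.
have -> : mu (sim true @^-1` [set 0]) = 0%E.
  apply: subset_measure0 mu_setC01.
  - by apply: mS; exact: measurable_set1.
  - by apply: measurableC; exact: measurable_itv.
  move=> x /=; rewrite in_itv/= /contr /= => x0 /andP[? ?].
  by have := alpha_lt2; nra.
rewrite adde0 -(fineK (fin_num_measure mu _ (measurable_set1 0))) -EFinM.
by move=> [] z2; congr (_%:E); lra.
Qed.

Local Notation P := (mu \x mu)%E.

Lemma prod_mu_fin_num (X : set (measurableTypeR R * measurableTypeR R)) :
  measurable X -> P X \is a fin_num.
Proof.
move=> mX; rewrite ge0_fin_numE//.
apply: (@le_lt_trans _ _ (P (setT `*` setT))).
  by apply: le_measure; rewrite ?inE ?setXTT.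
have -> : P (setT `*` setT) = (mu setT * mu setT)%E by exact: product_measure1E.
by rewrite probability_setT mule1 ltry.
Qed.

(** Self-similarity extends from rectangles to each coordinate by uniqueness of the product measure.
    Applied to both coordinates in turn, it gives weight 1/4 to each pair of digits, and the two
    equal pairs both contribute [c]. *)
Lemma prod_mu_selfsimilar (X : set (measurableTypeR R * measurableTypeR R))
    (c : R) (z : bool -> R) :
  measurable X ->
  (forall a, fine (P ((fun p => (sim a p.1, sim a p.2)) @^-1` X)) = c) ->
  (forall a, fine (P ((fun p => (sim a p.1, sim (~~ a) p.2)) @^-1` X)) = z a) ->
  fine (P X) = c / 2 + (z true + z false) / 4.
Proof.
move=> mX same other.
have mS1 a : measurable_fun [set: measurableTypeR R * measurableTypeR R]
    (fun p => (sim a p.1, p.2)).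
  apply: measurable_fun_pair => //.
  by apply: measurableT_comp => //; exact: measurable_contr.
have mS2 a : measurable_fun [set: measurableTypeR R * measurableTypeR R]
    (fun p => (p.1, sim a p.2)).
  apply: measurable_fun_pair => //.
  by apply: measurableT_comp => //; exact: measurable_contr.
have pull (f : measurableTypeR R * measurableTypeR R ->
      measurableTypeR R * measurableTypeR R) Y :
    measurable_fun setT f -> measurable Y -> measurable (f @^-1` Y).
  by move=> mf mY; rewrite -[X in measurable X]setTI; exact: mf.
have ext1 Y : measurable Y -> P Y =
    (2^-1%:E * (P ((fun p => (sim false p.1, p.2)) @^-1` Y) +
                P ((fun p => (sim true p.1, p.2)) @^-1` Y)))%E.
  have [n nE] := average_measure P (mS1 false) (mS1 true).
  rewrite -nE; apply: product_measure_unique => A B mA mB.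
  have rect a : (P ((sim a @^-1` A) `*` B) = mu (sim a @^-1` A) * mu B)%E.
    by apply: product_measure1E => //; exact: mS.
  rewrite nE; transitivity
    (2^-1%:E * (mu (sim false @^-1` A) * mu B + mu (sim true @^-1` A) * mu B))%E.
    by congr (_ * (_ + _))%E; exact: rect.
  rewrite -ge0_muleDl// muleA; congr (_ * _)%E.
  exact/esym/mu_selfsimilar.
have ext2 Y : measurable Y -> P Y =
    (2^-1%:E * (P ((fun p => (p.1, sim false p.2)) @^-1` Y) +
                P ((fun p => (p.1, sim true p.2)) @^-1` Y)))%E.
  have [n nE] := average_measure P (mS2 false) (mS2 true).
  rewrite -nE; apply: product_measure_unique => A B mA mB.
  have rect a : (P (A `*` (sim a @^-1` B)) = mu A * mu (sim a @^-1` B))%E.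
    by apply: product_measure1E => //; exact: mS.
  rewrite nE; transitivity
    (2^-1%:E * (mu A * mu (sim false @^-1` B) + mu A * mu (sim true @^-1` B)))%E.
    by congr (_ * (_ + _))%E; exact: rect.
  rewrite -ge0_muleDr// muleCA; congr (_ * _)%E.
  exact/esym/mu_selfsimilar.
have fE Y Y1 Y2 : measurable Y1 -> measurable Y2 ->
    P Y = (2^-1%:E * (P Y1 + P Y2))%E ->
    fine (P Y) = 2^-1 * (fine (P Y1) + fine (P Y2)).
  by move=> m1 m2 ->; rewrite -[P Y1]fineK ?prod_mu_fin_num// -[P Y2]fineK ?prod_mu_fin_num.
pose X1 a : set (measurableTypeR R * measurableTypeR R) :=
  (fun p => (sim a p.1, p.2)) @^-1` X.
pose X2 a b : set (measurableTypeR R * measurableTypeR R) :=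
  (fun p => (p.1, sim b p.2)) @^-1` X1 a.
have mX1 a : measurable (X1 a) by apply: pull.
have mX2 a b : measurable (X2 a b) by apply: pull.
rewrite (fE X (X1 false) (X1 true) (mX1 _) (mX1 _) (ext1 _ mX)).
have step a : fine (P (X1 a)) =
    2^-1 * (fine (P (X2 a false)) + fine (P (X2 a true))).
  exact: fE (mX2 _ _) (mX2 _ _) (ext2 _ (mX1 a)).
have step_eq a : fine (P (X1 a)) = 2^-1 * (c + z a).
  rewrite step -(same a) -(other a).
  by case: (a); [rewrite addrC|].
by rewrite (step_eq false) (step_eq true); field.
Qed.
End selfsimilar.

(** * Correlation sums *)

Lemma measurable_close_pairs (R : realType)
    (f : measurableTypeR R -> measurableTypeR R) (ell : option nat) (r : R) :
  measurable_fun setT f -> measurable (close_pairs f ell r).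
Proof.
move=> mf.
have mi i : measurable_fun [set: measurableTypeR R] (iter i f).
  elim: i => [|i IH]; first exact: measurable_id.
  exact: measurableT_comp mf IH.
have mdist i : measurable [set p : measurableTypeR R * measurableTypeR R |
    `|iter i f p.1 - iter i f p.2| <= r].
  have mle : measurable_fun [set: measurableTypeR R * measurableTypeR R]
      (fun p => `|iter i f p.1 - iter i f p.2| <= r).
    apply: measurable_fun_ler => //; apply: measurableT_comp => //.
    apply: measurable_funB.
      exact: measurableT_comp (mi i) measurable_fst.
    exact: measurableT_comp (mi i) measurable_snd.
  by have := mle measurableT [set true] Logic.I; rewrite setTI.
have -> : close_pairs f ell r =
    ([set` `[0, 1]] `*` [set` `[0, 1]]) `&`
    \bigcap_(i in [set i | below_length ell i])
      [set p | `|iter i f p.1 - iter i f p.2| <= r].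
  apply/seteqP; split=> p.
    move=> [p1 p2 /varrho_leP h]; split; first by split; rewrite /= in_itv.
    exact: h.
  by move=> [[/=]]; rewrite !in_itv/= => p1 p2 h; split=> //; exact/varrho_leP.
apply: measurableI; first by apply: measurableX; exact: measurable_itv.
by apply: bigcap_measurableType => i _; exact: mdist.
Qed.

Section determinism.
Variables (R : realType) (alpha : R).
Hypotheses (alpha_gt0 : 0 < alpha) (alpha_lt2 : 2 * alpha < 1).
Variable mu : probability (measurableTypeR R) R.
Hypothesis hmu : is_mualpha alpha mu.

Local Notation sim := (contr alpha : bool -> measurableTypeR R -> measurableTypeR R).
Local Notation P := (mu \x mu)%E.
Local Notation f := (falpha alpha : measurableTypeR R -> measurableTypeR R).

(** A set of full measure on which the extra hypothesis of [varrho_contr_neq] holds; sets of pairs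
    are compared on its square only. *)
Let cyl1 : set (measurableTypeR R) := \bigcup_(u : 1.-tuple bool) Ialpha alpha u.

Let measurable_cyl1 : measurable cyl1.
Proof.
apply: fin_bigcup_measurable; first exact: finite_finset.
by move=> u _; exact: measurable_Ialpha.
Qed.

Let cyl1_contr x : cyl1 x -> exists b y, 0 <= y <= 1 /\ x = contr alpha b y.
Proof.
move=> [u _]; case/tupleP: u => b u; have [y ->] := contr_surj alpha_gt0 b x.
move=> /(Ialpha_cons alpha_gt0) /(Ialpha_sub01 alpha_gt0 alpha_lt2) /=.
by rewrite in_itv/= => y01; exists b, y.
Qed.

Let cyl1_01 x : cyl1 x -> 0 <= x <= 1.
Proof.
by move=> /cyl1_contr[b [y [y01 ->]]]; exact: contr_itv.
Qed.

(** The complement of the square of [cyl1] lies in two null strips. *)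
Lemma fine_prod_mu_eq (X Y : set (measurableTypeR R * measurableTypeR R)) :
  measurable X -> measurable Y ->
  (forall x y, cyl1 x -> cyl1 y -> X (x, y) <-> Y (x, y)) ->
  fine (P X) = fine (P Y).
Proof.
move=> mX mY XY.
have mK := measurable_cyl1.
have mKC : measurable (~` cyl1) by exact: measurableC.
have K0 : mu (~` cyl1) = 0%E.
  apply: (measure_setC_Ialpha alpha_gt0 alpha_lt2 (probability_setT mu)).
  exact: is_mualpha_cyl.
have mG : measurable (cyl1 `*` cyl1) by exact: measurableX.
have G0 : P (~` (cyl1 `*` cyl1)) = 0%E.
  have Z1 : P (~` cyl1 `*` setT) = 0%E.
    transitivity (mu (~` cyl1) * mu setT)%E; first exact: product_measure1E.
    by rewrite K0 mul0e.
  have Z2 : P (setT `*` ~` cyl1) = 0%E.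
    transitivity (mu setT * mu (~` cyl1))%E; first exact: product_measure1E.
    by rewrite K0 mule0.
  apply: (@subset_measure0 _ _ _ _ _
    ((~` cyl1 `*` setT) `|` (setT `*` ~` cyl1))).
  - exact: measurableC.
  - by apply: measurableU; exact: measurableX.
  - move=> [x y] /= /not_andP[nx|ny]; [by left|by right].
  - by rewrite -[RHS]Z1; apply: measureU0 => //; exact: measurableX.
congr fine; rewrite (measureI_conull mG mX G0) (measureI_conull mG mY G0).
congr (P _); apply/seteqP; split=> -[x y] [+ [/= Kx Ky]];
  by move=> /(XY x y Kx Ky).
Qed.

Let mclose ell r : measurable (close_pairs f ell r).
Proof. by apply: measurable_close_pairs; exact: measurable_falpha. Qed.

Let mpull a b (X : set (measurableTypeR R * measurableTypeR R)) :
  measurable X -> measurable ((fun p => (sim a p.1, sim b p.2)) @^-1` X).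
Proof.
have m : measurable_fun [set: measurableTypeR R * measurableTypeR R]
    (fun p => (sim a p.1, sim b p.2)).
  by apply: measurable_fun_pair; apply: measurableT_comp => //;
    exact: measurable_contr.
by move=> mX; rewrite -[X in measurable X]setTI; exact: m.
Qed.

Lemma corr_sum_oo_scale (r : R) : r < 1 ->
  corr_sum mu f None (alpha * r) = corr_sum mu f None r / 2.
Proof.
move=> r1; rewrite /corr_sum.
have same a : fine (P ((fun p => (sim a p.1, sim a p.2)) @^-1`
    close_pairs f None (alpha * r))) = fine (P (close_pairs f None r)).
  apply: fine_prod_mu_eq => //; first exact: mpull.
  move=> x y /cyl1_01 x01 /cyl1_01 y01.
  have cc := varrho_contr_eq alpha_gt0 alpha_lt2 a r x01 y01.
  split=> -[/= _ _ h]; split=> //=; try exact: contr_itv; exact/cc.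
have other a : fine (P ((fun p => (sim a p.1, sim (~~ a) p.2)) @^-1`
    close_pairs f None (alpha * r))) = 0.
  rewrite -[RHS]/(fine 0%E) -(measure0 P).
  apply: fine_prod_mu_eq => //; first exact: mpull.
  move=> x y Kx Ky; split=> // -[/= _ _]; case: a => /= h.
    (* Here the first point has digit 1, so the two points exchange roles by symmetry of the
       distance. *)
    apply: (varrho_contr_neq alpha_gt0 alpha_lt2 (cyl1_01 Ky) r1 (cyl1_contr Kx)).
    apply/varrho_leP => i il; rewrite distrC.
    by move: i il; exact/varrho_leP.
  exact: (varrho_contr_neq alpha_gt0 alpha_lt2 (cyl1_01 Kx) r1 (cyl1_contr Ky)) h.
rewrite (prod_mu_selfsimilar alpha_gt0 alpha_lt2 hmu (mclose _ _) same other).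
by rewrite addr0 mul0r addr0.
Qed.

Lemma corr_sum1_scale (r : R) :
  corr_sum mu f (Some 1%N) r / 2 <= corr_sum mu f (Some 1%N) (alpha * r) /\
  (alpha * r <= 1 - 2 * alpha ->
   corr_sum mu f (Some 1%N) (alpha * r) = corr_sum mu f (Some 1%N) r / 2).
Proof.
have a0 := alpha_gt0.
rewrite /corr_sum.
have same a : fine (P ((fun p => (sim a p.1, sim a p.2)) @^-1`
    close_pairs f (Some 1%N) (alpha * r))) =
    fine (P (close_pairs f (Some 1%N) r)).
  apply: fine_prod_mu_eq => //; first exact: mpull.
  have dist (u v : R) :
      (`|contr alpha a u - contr alpha a v| <= alpha * r) = (`|u - v| <= r).
    have -> : contr alpha a u - contr alpha a v = alpha * (u - v).
      by rewrite /contr; ring.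
    by rewrite normrM gtr0_norm// ler_pM2l.
  move=> x y /cyl1_01 x01 /cyl1_01 y01; split=> -[/= _ _ /varrho_leP h];
    split=> //=; try exact: contr_itv.
  - by apply/varrho_leP => -[|//] _ /=; rewrite -dist; exact: (h 0).
  - by apply/varrho_leP => -[|//] _ /=; rewrite dist; exact: (h 0).
have other a : alpha * r <= 1 - 2 * alpha ->
    fine (P ((fun p => (sim a p.1, sim (~~ a) p.2)) @^-1`
      close_pairs f (Some 1%N) (alpha * r))) = 0.
  move=> r2.
  (* When [alpha * r] equals the gap width [1 - 2 * alpha], the gap endpoints [alpha] and
     [1 - alpha] are still close. They are the images of 1 and 0, so the coordinate with digit 1
     must be 0, which is a null condition. *)
  pose Z : set (measurableTypeR R * measurableTypeR R) :=
    if a then [set 0] `*` setT else setT `*` [set 0].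
  have m0 := measurable_set1 (0 : R).
  have mZ : measurable Z by rewrite /Z; case: (a); exact: measurableX.
  have Z0 : P Z = 0%E.
    have mu0 := mu_set1_0 alpha_gt0 alpha_lt2 hmu.
    rewrite /Z; case: (a).
      transitivity (mu [set 0%R] * mu setT)%E; first exact: product_measure1E.
      by rewrite mu0 mul0e.
    transitivity (mu setT * mu [set 0%R])%E; first exact: product_measure1E.
    by rewrite mu0 mule0.
  set X := (_ @^-1` _).
  have mX : measurable X by exact: mpull.
  rewrite (fine_prod_mu_eq mX (measurableI _ _ mX mZ)).
    have -> // : P (X `&` Z) = 0%E.
    by apply: subset_measure0 Z0 => //; exact: measurableI.
  move=> x y /cyl1_01/andP[x0 x1] /cyl1_01/andP[y0 y1]; split=> [|[//]] Xxy.
  split=> //; move: Xxy => [/= _ _ /varrho_leP/(_ 0 isT) /=].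
  rewrite /Z ler_norml /contr.
  case: (a) => /= /andP[h1 h2]; split=> //=.
    by have : 1 + (x - y) <= 0; [rewrite -(pmulr_rle0 _ a0); lra|lra].
  by have : 1 + (y - x) <= 0; [rewrite -(pmulr_rle0 _ a0); lra|lra].
pose z a := fine (P ((fun p => (sim a p.1, sim (~~ a) p.2)) @^-1`
    close_pairs f (Some 1%N) (alpha * r))).
have z0 a : 0 <= z a by exact: fine_ge0.
rewrite (prod_mu_selfsimilar alpha_gt0 alpha_lt2 hmu (mclose _ _) same
  (fun a => erefl (z a))).
split=> [|r2]; first by rewrite lerDl divr_ge0// addr_ge0.
have zE a : z a = 0 by exact: other.
by rewrite (zE true) (zE false) addr0 mul0r addr0.
Qed.

(** Makes the numerator of [det_oo] vanish whenever its denominator does. *)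
Lemma corr_sum_oo_le (r : R) : corr_sum mu f None r <= corr_sum mu f (Some 1%N) r.
Proof.
rewrite /corr_sum fine_le ?prod_mu_fin_num//.
apply: le_measure; rewrite ?inE// => p [p1 p2 /varrho_leP h]; split=> //.
by apply/varrho_leP => i _; exact: h.
Qed.

End determinism.

Theorem lemma27 (R : realType) (alpha : R) (halpha : 0 < alpha < 1 / 2)
    (mu : probability (measurableTypeR R) R) (hmu : is_mualpha alpha mu)
    (r : R) (hr : 0 < r < 1) :
  det_oo mu (falpha alpha) (alpha * r) <= det_oo mu (falpha alpha) r /\
  (r <= (1 - 2 * alpha) / alpha ->
   det_oo mu (falpha alpha) (alpha * r) = det_oo mu (falpha alpha) r).
Proof.
have /andP[a0 a12] := halpha; have /andP[r0 r1] := hr.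
have a2 : 2 * alpha < 1 by lra.
have [c1_ge c1_eq] := corr_sum1_scale a0 a2 hmu r.
rewrite /det_oo (corr_sum_oo_scale a0 a2 hmu r1).
have c0 : 0 <= corr_sum mu (falpha alpha) None r by exact: fine_ge0.
have := corr_sum_oo_le a0 a2 mu r.
move: c1_ge c1_eq c0; set c := corr_sum _ _ None _.
set d := corr_sum _ _ _ r; set d' := corr_sum _ _ _ _ => c1_ge c1_eq c0 cd.
split=> [|r2]; last first.
  rewrite c1_eq; last by rewrite mulrC -ler_pdivlMr.
  by rewrite invfM invrK mulrACA mulVf ?mulr1// pnatr_eq0.
(* If [d] is not positive, [0 <= c <= d] gives [c = 0], and both quotients are 0 whatever their
   denominators. *)
have [d0|d0] := leP d 0.
  have -> : c = 0 by lra.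
  by rewrite !mul0r.
have d'0 : 0 < d' by lra.
rewrite ler_pdivrMr// mulrAC ler_pdivlMr//; nra.
Qed.
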